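(* Consider the sequence of binary classification problems indexed by $m$ described in the context. There exists an asymptotically consistent classifier $\phi=\{\phi_m\}_{m\ge1}$ if and only if $$m=o\big(\min\{N^2,\,Nn\}\big)\qquad (m\to\infty).$$
   Context: For each integer $m\ge1$ let $[m]=\{1,\dots,m\}$ be the alphabet. The sample sizes $N=N(m)$ and $n=n(m)$ are positive integers with $N,n\to\infty$ as $m\to\infty$. Fix constants $\varepsilon>0$ and $\bar c>0$ (a large positive constant). Let $\mathcal P_m$ be the set of pairs $(\pi,\mu)$ of probability distributions on $[m]$ with $\|\mu-\pi\|_1\ge\varepsilon$, $\max_j\pi_j\le \bar c/m$ and $\max_j\mu_j\le\bar c/m$. Two training sequences $X=(X_1,\dots,X_N)$ i.i.d. with marginal $\pi$ and $Y=(Y_1,\dots,Y_N)$ i.i.d. with marginal $\mu$, and a test sequence $Z=(Z_1,\dots,Z_n)$ i.i.d. with marginal $\nu$ are observed, the three sequences being independent; $\mathsf P_{(\pi,\mu,\nu)}$ denotes the corresponding probability. Under the null hypothesis $\nu=\pi$, under the alternative $\nu=\mu$. A classifier is a sequence $\phi=\{\phi_m\}$ of functions $\phi_m:[m]^N\times[m]^N\times[m]^n\to\{0,1\}$ (output $1$ means deciding the alternative). Its worst-case average probability of error is $$P_e(\phi_m)=\sup_{(\pi,\mu)\in\mathcal P_m}\Big[\tfrac12\mathsf P_{(\pi,\mu,\pi)}\{\phi_m=1\}+\tfrac12\mathsf P_{(\pi,\mu,\mu)}\{\phi_m=0\}\Big].$$ The classifier is asymptotically consistent if $\lim_{m\t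o\infty}P_e(\phi_m)=0$.
   Formalization: The claim is proved for 0 < ε < 2 and every c̄ above a threshold depending only on ε (''large''); it fails for ε > 2 (no admissible pairs) and for ε = 2 (disjoint supports make the N² condition unnecessary, e.g. N ≈ √m, n = m). *)

(* Defs.v *)
From HB Require Import structures.
From mathcomp Require Import all_boot all_order all_algebra.
From mathcomp Require Import all_classical all_reals all_analysis.
Set Implicit Arguments. Unset Strict Implicit. Unset Printing Implicit Defensive.
Import Order.TTheory GRing.Theory Num.Theory.
Import numFieldNormedType.Exports.
Local Open Scope classical_set_scope.
Local Open Scope ring_scope.

(* The alphabet [m] = {1,...,m} is represented by 'I_m = {0,...,m-1}. *)

Notation word m k := {ffun 'I_k -> 'I_m}.

Section Defs.
Variable R : realType.

Definition is_distr (m : nat) (p : 'I_m -> R) : Prop :=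
  (forall j, 0 <= p j) /\ \sum_(j < m) p j = 1.

Definition l1dist (m : nat) (p q : 'I_m -> R) : R := \sum_(j < m) `|q j - p j|.

Definition admissible (eps cbar : R) (m : nat) (pi mu : 'I_m -> R) : Prop :=
  [/\ is_distr pi, is_distr mu, eps <= l1dist pi mu,
      (forall j, pi j <= cbar / m%:R) & (forall j, mu j <= cbar / m%:R)].

Definition word_prob (m k : nat) (p : 'I_m -> R) (x : word m k) : R :=
  \prod_(i < k) p (x i).

Definition prob_out (m N n : nat) (phi : word m N -> word m N -> word m n -> bool)
    (pi mu nu : 'I_m -> R) (b : bool) : R :=
  \sum_(x : word m N) \sum_(y : word m N) \sum_(z : word m n)
     (phi x y z == b)%:R * (word_prob pi x * word_prob mu y * word_prob nu z).

Definition Perr (eps cbar : R) (m N n : nat)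
    (phi : word m N -> word m N -> word m n -> bool) : R :=
  sup [set e | exists pi mu : 'I_m -> R, admissible eps cbar pi mu /\
        e = 2^-1 * prob_out phi pi mu pi true + 2^-1 * prob_out phi pi mu mu false].

Definition asympt_consistent (eps cbar : R) (N n : nat -> nat)
    (phi : forall m : nat, word m (N m) -> word m (N m) -> word m (n m) -> bool) : Prop :=
  (fun m => Perr eps cbar (phi m)) @ \oo --> (0 : R).

End Defs.

Definition tends_to_infty (f : nat -> nat) : Prop :=
  forall K : nat, exists M : nat, forall m : nat, (M <= m)%N -> (K <= f m)%N.

(* Main.v *)
Require Import Defs.
From HB Require Import structures.
From mathcomp Require Import all_boot all_order all_algebra.
From mathcomp Require Import all_classical all_reals all_analysis.
From mathcomp Require Import ring lra.
Set Implicit Arguments. Unset Strict Implicit. Unset Printing Implicit Defensive.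
Import Order.TTheory GRing.Theory Num.Theory.
Import numFieldNormedType.Exports.
Local Open Scope classical_set_scope.
Local Open Scope ring_scope.

(**
Achievability: with m = o(min(N^2, N n)), count the matches of letters between
X and Z, between Y and Z, inside X and inside Y. A suitable combination of the
counts has mean |pi - mu|_2^2 / 2 when nu = pi and the opposite when nu = mu,
and |pi - mu|_2^2 >= eps^2 / m by Cauchy-Schwarz. Its variance is
O(1 / (m N n) + 1 / (m N^2) + 1 / (m^2 N) + 1 / (m^2 n)), so Chebyshev's
inequality makes the sign of the statistic a consistent test.

Converse: cut the alphabet into B blocks of c letters and let s choose one
letter in every block at random, which gives the law mu_s uniform on the chosen
letters. If N^2 = O(m), then with probability bounded below no block is repeated
in X nor in Y, in which case (X, Y) has the same distribution under
(uniform, mu_s) and under (mu_s, uniform), while Z is uniform under both; the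
L1 distance of these laws is 2 - 2 / c, hence the need of a large cbar when eps
is close to 2. If N n = O(m), take c = 2 and let pi and mu be the laws on the
chosen and on the remaining letters: with probability bounded below, no block of
Z appears in X or Y, and then Z does not distinguish pi from mu.
*)

(** * Matches in samples of independent letters *)

Section Product.
Variables (R : realFieldType) (I A : finType) (p : I -> A -> R).

(** The law may vary with the coordinate, so that three samples with different laws can be read as a
    single word indexed by a sum type. *)
Definition expect (f : {ffun I -> A} -> R) : R :=
  \sum_(w : {ffun I -> A}) (\prod_i p i (w i)) * f w.

Definition upd (w : {ffun I -> A}) (i : I) (a : A) : {ffun I -> A} :=
  [ffun k => if k == i then a else w k].

Definition meet (i j : I) (w : {ffun I -> A}) : R := (w i == w j)%:R.

Definition overlap (i j : I) : R := \sum_a p i a * p j a.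

Hypothesis p_ge0 : forall i a, 0 <= p i a.
Hypothesis p_sum : forall i, \sum_a p i a = 1.

Lemma prod_ge0 (w : {ffun I -> A}) : 0 <= \prod_i p i (w i).
Proof. by apply: prodr_ge0 => i _. Qed.

Lemma expect_le f g : (forall w, f w <= g w) -> expect f <= expect g.
Proof. by move=> fg; apply: ler_sum => w _; rewrite ler_wpM2l ?prod_ge0. Qed.

Lemma expect_ge0 f : (forall w, 0 <= f w) -> 0 <= expect f.
Proof. by move=> f0; apply: sumr_ge0 => w _; rewrite mulr_ge0 ?prod_ge0. Qed.

Lemma eq_expect f g : f =1 g -> expect f = expect g.
Proof. by move=> fg; apply: eq_bigr => w _; rewrite fg. Qed.

Lemma expectZ c f : expect (fun w => c * f w) = c * expect f.
Proof. by rewrite /expect mulr_sumr; apply: eq_bigr => w _; rewrite mulrCA. Qed.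

Lemma expectD f g : expect (fun w => f w + g w) = expect f + expect g.
Proof. by rewrite -big_split; apply: eq_bigr => w _; rewrite mulrDr. Qed.

Lemma expect_sum (J : finType) (F : J -> {ffun I -> A} -> R) :
  expect (fun w => \sum_j F j w) = \sum_j expect (F j).
Proof.
rewrite /expect [RHS]exchange_big; apply: eq_bigr => w _.
by rewrite mulr_sumr.
Qed.

Lemma expect1 : expect (fun=> 1) = 1.
Proof.
rewrite /expect; under eq_bigr do rewrite mulr1.
rewrite -(bigA_distr_bigA (fun i a => p i a)) big1 // => i _; exact: p_sum.
Qed.

Lemma expect_cst c : expect (fun=> c) = c.
Proof.
by rewrite -[RHS]mulr1 -[in RHS]expect1 -expectZ; apply: eq_expect => w; rewrite mulr1.
Qed.

Lemma updE w i a : upd w i a i = a.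
Proof. by rewrite ffunE eqxx. Qed.

Lemma upd_neq w i a k : k != i -> upd w i a k = w k.
Proof. by rewrite ffunE => /negPf ->. Qed.

Lemma upd_upd w i a b : upd (upd w i a) i b = upd w i b.
Proof. by apply/ffunP => k; rewrite !ffunE; case: eqP. Qed.

Lemma upd_id w i : upd w i (w i) = w.
Proof. by apply/ffunP => k; rewrite ffunE; case: eqP => [->|]. Qed.

(** Redrawing one coordinate leaves a product law invariant: exchanging the old letter with the new
    one is an involution on pairs (word, letter). Independence enters the computations on matches
    through this identity. *)
Lemma expect_resample i f :
  expect f = expect (fun w => \sum_a p i a * f (upd w i a)).
Proof.
pose swap (u : {ffun I -> A} * A) := (upd u.1 i u.2, u.1 i).
have swapK : involutive swap.
  by move=> [w a]; rewrite /swap /= updE upd_upd upd_id.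
rewrite /expect; under [RHS]eq_bigr do rewrite mulr_sumr.
rewrite pair_big (reindex_inj (inv_inj swapK)) /=.
rewrite -(pair_big xpredT xpredT (fun w a => \prod_k p k (upd w i a k) *
  (p i (w i) * f (upd (upd w i a) i (w i))))) /=.
apply: eq_bigr => w _; under [RHS]eq_bigr do rewrite upd_upd upd_id.
(* The left side does not weigh the spare letter yet; multiplying it by the total mass of [p i]
   supplies this weight. *)
rewrite -[LHS]mul1r -[X in X * _](p_sum i) mulr_suml; apply: eq_bigr => a _.
rewrite !mulrA; congr (_ * _).
rewrite (bigD1 i) //= [in RHS](bigD1 i) //= updE.
rewrite mulrA mulrAC; congr (_ * _).
by congr (_ * _); apply: eq_bigr => k /upd_neq ->.
Qed.

Lemma meetC i j w : meet i j w = meet j i w.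
Proof. by rewrite /meet eq_sym. Qed.

Lemma meet_ge0 i j w : 0 <= meet i j w.
Proof. exact: ler0n. Qed.

Lemma meet_le1 i j w : meet i j w <= 1.
Proof. by rewrite /meet; case: eqP. Qed.

Lemma meet_upd i k l w a : i != k -> i != l -> meet k l (upd w i a) = meet k l w.
Proof. by move=> ik il; rewrite /meet !upd_neq // eq_sym. Qed.

(** When letter [i] is redrawn, only the value [w j] produces a match, with probability [p i (w j)],
    and [g] does not see the change. *)
Lemma expect_meetM i j g : i != j -> (forall w a, g (upd w i a) = g w) ->
  expect (fun w => meet i j w * g w) = expect (fun w => p i (w j) * g w).
Proof.
move=> ij gi; rewrite (expect_resample i); apply: eq_expect => w.
rewrite (bigD1 (w j)) //= big1 ?addr0 => [|a aj].
  by rewrite gi /meet updE upd_neq ?eqxx ?mul1r // eq_sym.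
by rewrite /meet updE upd_neq 1?eq_sym // eq_sym (negPf aj) mul0r mulr0.
Qed.

Lemma expect_meetM_indep i j g : i != j -> (forall w a, g (upd w i a) = g w) ->
  (forall w a, g (upd w j a) = g w) ->
  expect (fun w => meet i j w * g w) = overlap i j * expect g.
Proof.
move=> ij gi gj; rewrite (expect_meetM ij gi) (expect_resample j) -expectZ.
apply: eq_expect => w; rewrite mulr_suml; apply: eq_bigr => a _.
by rewrite gj updE mulrA [p j a * _]mulrC.
Qed.

Lemma expect_meet i j : i != j -> expect (meet i j) = overlap i j.
Proof.
move=> ij; rewrite -[RHS]mulr1 -expect1 -expect_meetM_indep //.
by apply: eq_expect => w; rewrite mulr1.
Qed.

Variable k : R.
Hypothesis k_ge0 : 0 <= k.
Hypothesis p_le : forall i a, p i a <= k.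

Lemma expect_meet_ub i j : i != j -> expect (meet i j) <= k.
Proof.
move=> ij.
have -> : expect (meet i j) = expect (fun w => meet i j w * 1).
  by apply: eq_expect => w; rewrite mulr1.
rewrite expect_meetM // -[leRHS]expect_cst; apply: expect_le => w.
by rewrite mulr1.
Qed.

Lemma overlap_ge0 i j : 0 <= overlap i j.
Proof. by apply: sumr_ge0 => a _; rewrite mulr_ge0. Qed.

Lemma overlap_le i j : overlap i j <= k.
Proof.
rewrite -[leRHS]mulr1 -(p_sum j) mulr_sumr; apply: ler_sum => a _.
by rewrite ler_wpM2r.
Qed.

(** Since [i] is outside the second pair, redrawing it yields a factor [k] even when [j] is shared;
    the second match yields the other [k]. *)
Lemma expect_meet2_le i j r s : i != j -> r != s -> i != r -> i != s ->
  expect (fun w => meet i j w * meet r s w) <= k ^+ 2.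
Proof.
move=> ij rs ir si; rewrite expect_meetM // => [|w a]; last exact: meet_upd.
apply: (@le_trans _ _ (expect (fun w => k * meet r s w))).
  by apply: expect_le => w; rewrite ler_wpM2r ?meet_ge0.
by rewrite expectZ expr2 ler_wpM2l ?k_ge0 // expect_meet_ub.
Qed.

(* Two pairs with no common index are independent, with one common index the
   joint match has probability at most k ^ 2, and only equal pairs cost k. *)
Lemma cov_meet_le i j r s : i != j -> r != s ->
  `|expect (fun w => meet i j w * meet r s w) - overlap i j * overlap r s| <=
  k * (((i == r) && (j == s))%:R + ((i == s) && (j == r))%:R) +
  k ^+ 2 * ((i == r)%:R + (i == s)%:R + (j == r)%:R + (j == s)%:R).
Proof.
move=> ij rs; have k0 := k_ge0.
have dist_le (x y b : R) : 0 <= x -> 0 <= y -> x <= b -> y <= b -> `|x - y| <= b.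
  by move=> x0 y0 xb yb; rewrite ler_norml; lra.
have E0 : 0 <= expect (fun w => meet i j w * meet r s w).
  by apply: expect_ge0 => w; rewrite mulr_ge0 ?meet_ge0.
have O0 : 0 <= overlap i j * overlap r s by rewrite mulr_ge0 ?overlap_ge0.
have Ok : overlap i j * overlap r s <= k ^+ 2.
  by rewrite expr2 ler_pM ?overlap_ge0 ?overlap_le.
have Ek : expect (fun w => meet i j w * meet r s w) <= k.
  apply: le_trans (expect_meet_ub ij); apply: expect_le => w.
  by rewrite ler_piMr ?meet_ge0 ?meet_le1.
have Ei : i != r -> i != s ->
    expect (fun w => meet i j w * meet r s w) <= k ^+ 2.
  exact: expect_meet2_le.
have Ej : j != r -> j != s ->
    expect (fun w => meet i j w * meet r s w) <= k ^+ 2.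
  move=> jr js; rewrite (eq_expect (g := fun w => meet j i w * meet r s w)).
    by rewrite expect_meet2_le // eq_sym.
  by move=> w; rewrite meetC.
have k20 : 0 <= k ^+ 2 by rewrite sqr_ge0.
(* Unless [i = j], either the two pairs agree up to order, and [Ek] applies, or [i] or [j] is
   outside the other pair, and [Ei] or [Ej] applies. The one goal left is that of disjoint pairs,
   whose covariance is exactly 0. *)
have [ir|ir] := eqVneq i r; have [js|js] := eqVneq j s;
  have [is_|is_] := eqVneq i s; have [jr|jr] := eqVneq j r;
  rewrite /= ?mulr0n ?mulr1n;
  try (by case/eqP: ij; congruence);
  try (by apply: dist_le => //; lra);
  try (by apply: dist_le => //; have := Ei ir is_; lra);
  try (by apply: dist_le => //; have := Ej jr js; lra).
rewrite expect_meetM_indep // => [|w a|w a]; try exact: meet_upd.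
by rewrite expect_meet // subrr normr0; lra.
Qed.

Variable a : I -> I -> R.
Hypothesis a_diag : forall i, a i i = 0.

Definition meet_stat (w : {ffun I -> A}) : R := \sum_i \sum_j a i j * meet i j w.

Lemma expect_meet_stat :
  expect meet_stat = \sum_i \sum_j a i j * overlap i j.
Proof.
rewrite expect_sum; apply: eq_bigr => i _; rewrite expect_sum.
apply: eq_bigr => j _; rewrite expectZ.
by have [->|ij] := eqVneq i j; rewrite ?a_diag ?mul0r // expect_meet.
Qed.

(** The variance is a double sum of covariances, each bounded by [cov_meet_le]. Equal or reversed
    pairs give the first term; pairs that share an index are grouped by this index, which gives the
    squared sums of row plus column. *)
Lemma variance_meet_stat :
  expect (fun w => (meet_stat w - expect meet_stat) ^+ 2) <=
  2 * k * (\sum_i \sum_j a i j ^+ 2) +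
  k ^+ 2 * \sum_i (\sum_j (`|a i j| + `|a j i|)) ^+ 2.
Proof.
pose b (u : I * I) := a u.1 u.2.
pose M (u : I * I) w := meet u.1 u.2 w.
pose O (u : I * I) := overlap u.1 u.2.
have SE w : meet_stat w = \sum_u b u * M u w by rewrite /meet_stat pair_big.
have eE : expect meet_stat = \sum_u b u * O u.
  by rewrite expect_meet_stat pair_big.
have -> : expect (fun w => (meet_stat w - expect meet_stat) ^+ 2) =
    \sum_u \sum_v b u * b v * (expect (fun w => M u w * M v w) - O u * O v).
  have -> : expect (fun w => (meet_stat w - expect meet_stat) ^+ 2) =
      expect (fun w => meet_stat w ^+ 2) - (expect meet_stat) ^+ 2.
    set e := expect meet_stat.
    rewrite (eq_expect (g := fun w =>
        meet_stat w ^+ 2 + ((- 2 * e) * meet_stat w + e ^+ 2))).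
      by rewrite !expectD expect_cst expectZ -/e; ring.
    by move=> w; ring.
  rewrite (eq_expect (g := fun w => \sum_u \sum_v b u * b v * (M u w * M v w))).
    rewrite expect_sum eE expr2 mulr_suml -sumrB; apply: eq_bigr => u _.
    rewrite expect_sum mulr_sumr -sumrB; apply: eq_bigr => v _.
    by rewrite expectZ; ring.
  move=> w; rewrite SE expr2 mulr_suml; apply: eq_bigr => u _.
  by rewrite mulr_sumr; apply: eq_bigr => v _; ring.
(* Every indicator of [cov_meet_le] gets its own term, so that the six double sums can be evaluated
   separately. *)
pose T (u v : I * I) : R :=
  k * (`|b u| * `|b v| * (u == v)%:R + `|b u| * `|b v| * ((u.2, u.1) == v)%:R) +
  k ^+ 2 * (`|b u| * `|b v| * (u.1 == v.1)%:R + `|b u| * `|b v| * (u.1 == v.2)%:R +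
    `|b u| * `|b v| * (u.2 == v.1)%:R + `|b u| * `|b v| * (u.2 == v.2)%:R).
apply: (@le_trans _ _ (\sum_u \sum_v T u v)).
  apply: ler_sum => -[i j] _; apply: ler_sum => -[r s] _.
  rewrite /T /b /M /O /= !xpair_eqE.
  have [->|ij] := eqVneq i j; first by rewrite a_diag normr0 !(mul0r,mulr0,addr0).
  have [->|rs] := eqVneq r s; first by rewrite a_diag normr0 !(mul0r,mulr0,addr0).
  apply: le_trans (ler_norm _) _; rewrite !normrM.
  apply: (le_trans (ler_wpM2l _ (cov_meet_le ij rs))); first exact: mulr_ge0.
  rewrite [(j == r) && _]andbC; lra.
have sumT (c : R) (F G H K L J : I * I -> I * I -> R) :
  \sum_u \sum_v (k * (F u v + G u v) + c * (H u v + K u v + L u v + J u v)) =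
  k * (\sum_u \sum_v F u v + \sum_u \sum_v G u v) +
  c * (\sum_u \sum_v H u v + \sum_u \sum_v K u v + \sum_u \sum_v L u v +
       \sum_u \sum_v J u v).
  rewrite -!big_split !mulr_sumr -big_split; apply: eq_bigr => u _ /=.
  by rewrite -!big_split !mulr_sumr -big_split; apply: eq_bigr => v _ /=.
have diagonal (f g : I * I -> I) :
    \sum_u \sum_v `|b u| * `|b v| * (f u == g v)%:R =
    \sum_i (\sum_(u | f u == i) `|b u|) * (\sum_(v | g v == i) `|b v|).
  rewrite (partition_big f xpredT) //=; apply: eq_bigr => i _.
  rewrite mulr_suml; apply: eq_bigr => u /eqP <-.
  rewrite mulr_sumr [RHS]big_mkcond; apply: eq_bigr => v _ /=.
  by rewrite eq_sym; case: eqP; rewrite ?mulr1 ?mulr0.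
have row i : \sum_(u : I * I | u.1 == i) `|b u| = \sum_j `|a i j|.
  transitivity (\sum_(i' | i' == i) \sum_j `|a i' j|).
    by rewrite pair_big /=; apply: eq_bigl => u; rewrite andbT.
  by rewrite big_pred1_eq.
have col i : \sum_(u : I * I | u.2 == i) `|b u| = \sum_j `|a j i|.
  transitivity (\sum_j \sum_(i' | i' == i) `|a j i'|); first by rewrite pair_big.
  by apply: eq_bigr => j _; rewrite big_pred1_eq.
have sqE : \sum_i \sum_j a i j ^+ 2 = \sum_u `|b u| ^+ 2.
  by rewrite pair_big; apply: eq_bigr => u _; rewrite real_normK ?num_real.
rewrite /T sumT !diagonal.
apply: lerD.
  rewrite -mulrA mulrCA; apply: ler_wpM2l; rewrite // sqE.
  have -> : \sum_u \sum_v `|b u| * `|b v| * (u == v)%:R = \sum_u `|b u| ^+ 2.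
    apply: eq_bigr => u _; rewrite (bigD1 u) //= big1 ?addr0 ?eqxx ?mulr1 //.
    by move=> v /negPf vu; rewrite eq_sym vu mulr0.
  have -> : \sum_u \sum_v `|b u| * `|b v| * ((u.2, u.1) == v)%:R =
      \sum_u `|b u| * `|b (u.2, u.1)|.
    apply: eq_bigr => u _; rewrite (bigD1 (u.2, u.1)) //= big1 ?addr0 ?eqxx ?mulr1 //.
    by move=> v /negPf vu; rewrite eq_sym vu mulr0.
  (* Reversing pairs preserves the sum of squares, so one of its two copies can be split evenly
     between [u] and its reverse and dominate the cross terms by [2 x y <= x ^ 2 + y ^ 2]. *)
  have -> : 2 * \sum_u `|b u| ^+ 2 =
      \sum_u `|b u| ^+ 2 + (\sum_u `|b u| ^+ 2 + \sum_u `|b (u.2, u.1)| ^+ 2) / 2.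
    have <- : \sum_u `|b u| ^+ 2 = \sum_u `|b (u.2, u.1)| ^+ 2.
      by rewrite (reindex_inj (inv_inj (f := fun u : I * I => (u.2, u.1)) _)) //= => -[].
    by field.
  rewrite lerD2l -big_split mulr_suml; apply: ler_sum => u _ /=.
  have := sqr_ge0 (`|b u| - `|b (u.2, u.1)|); lra.
apply: ler_wpM2l; first exact: sqr_ge0.
rewrite -!big_split; apply: ler_sum => i _ /=.
rewrite !row !col big_split /= le_eqVlt; apply/orP; left; apply/eqP; ring.
Qed.
End Product.

Lemma sum_cst (R : pzSemiRingType) k (c : R) : \sum_(j < k) c = k%:R * c.
Proof. by rewrite sumr_const card_ord mulr_natl. Qed.

(** * The collision statistic and its error by Chebyshev's inequality *)

Section CollisionClassifier.
Variables (R : realFieldType) (A : finType) (N n : nat).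

Notation index := (('I_N + 'I_N) + 'I_n)%type.

Definition join_samples (x y : {ffun 'I_N -> A}) (z : {ffun 'I_n -> A}) :
    {ffun index -> A} :=
  [ffun i : index =>
    match i with inl (inl i) => x i | inl (inr i) => y i | inr i => z i end].

Definition sample_law (p q r : A -> R) (i : index) : A -> R :=
  match i with inl (inl _) => p | inl (inr _) => q | inr _ => r end.

Lemma expect_join (p q r : A -> R) f :
  \sum_x \sum_y \sum_z f (join_samples x y z) *
    ((\prod_i p (x i)) * (\prod_i q (y i)) * (\prod_i r (z i))) =
  expect (sample_law p q r) f.
Proof.
pose split (w : {ffun index -> A}) :
    {ffun 'I_N -> A} * {ffun 'I_N -> A} * {ffun 'I_n -> A} :=
  ([ffun i => w (inl (inl i))], [ffun i => w (inl (inr i))], [ffun i => w (inr i)]).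
pose join u := join_samples u.1.1 u.1.2 u.2.
have joinK : cancel join split.
  by move=> [[x y] z]; congr (_, _, _); apply/ffunP => i; rewrite !ffunE.
have splitK : cancel split join.
  by move=> w; apply/ffunP => -[[i|i]|i]; rewrite !ffunE.
rewrite pair_big pair_big /= /expect (reindex join); last first.
  by exists split => w _; rewrite ?joinK ?splitK.
apply: eq_bigr => -[[x y] z] _ /=; rewrite mulrC; congr (_ * _).
rewrite !big_sumType /=; congr (_ * _ * _);
  by apply: eq_bigr => i _; rewrite ffunE.
Qed.

(* The statistic estimates <p - q, r> - (|p|^2 - |q|^2) / 2, i.e.
   |p - q|^2 / 2 when r = p and its opposite when r = q. *)
Definition weight (i j : index) : R :=
  match i, j with
  | inl (inl i), inl (inl j) => if j == i then 0 else - (2 * N * N.-1)%:R^-1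
  | inl (inr i), inl (inr j) => if j == i then 0 else (2 * N * N.-1)%:R^-1
  | inl (inl _), inr _ => (N * n)%:R^-1
  | inl (inr _), inr _ => - (N * n)%:R^-1
  | _, _ => 0
  end.

Lemma weight_diag i : weight i i = 0.
Proof. by case: i => [[i|i]|i] //=; rewrite eqxx. Qed.

Lemma sum_offdiag (i : 'I_N) (c : R) :
  \sum_(j < N) (if j == i then 0 else c) = N.-1%:R * c.
Proof.
rewrite (eq_bigr (fun j => if j != i then c else 0)) => [|j _]; last by case: eqP.
by rewrite -big_mkcond sumr_const cardC1 card_ord mulr_natl.
Qed.

Hypothesis N_gt1 : (1 < N)%N.
Hypothesis n_gt0 : (0 < n)%N.

Let Nn0 : N%:R != 0 :> R. Proof. by rewrite pnatr_eq0; case: N N_gt1. Qed.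
Let Np0 : N.-1%:R != 0 :> R. Proof. by rewrite pnatr_eq0; case: N N_gt1 => [|[]]. Qed.
Let nn0 : n%:R != 0 :> R. Proof. by rewrite pnatr_eq0; case: n n_gt0. Qed.

(** Each group of weights is normalised by its number of ordered pairs, [N * n] across samples and
    [N * N.-1] inside one (the diagonal is excluded), so each average of matches is unbiased for an
    inner product. *)
Lemma expect_stat (p q r : A -> R) :
  \sum_i \sum_j weight i j * overlap (sample_law p q r) i j =
  \sum_a (p a - q a) * r a - (\sum_a p a ^+ 2 - \sum_a q a ^+ 2) / 2.
Proof.
have offM (i : 'I_N) (c x : R) :
    \sum_(j < N) (if j == i then 0 else c) * x = N.-1%:R * c * x.
  by rewrite -mulr_suml sum_offdiag.
have zeroM k (x : R) : \sum_(j < k) 0 * x = 0 by rewrite big1 // => j _; rewrite mul0r.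
have -> : \sum_a (p a - q a) * r a = \sum_a p a * r a - \sum_a q a * r a.
  by rewrite -sumrB; apply: eq_bigr => a _; rewrite mulrBl.
rewrite !big_sumType /= [X in _ + X]big1 ?addr0; last first.
  by move=> i _; rewrite !big_sumType /overlap /= !zeroM !addr0.
under eq_bigr do rewrite !big_sumType /overlap /= zeroM offM sum_cst.
under [X in _ + X]eq_bigr do rewrite !big_sumType /overlap /= zeroM offM sum_cst.
rewrite !sum_cst !natrM.
under [X in _ = _ - (X - _) / _]eq_bigr do rewrite expr2.
under [X in _ = _ - (_ - X) / _]eq_bigr do rewrite expr2.
by field; rewrite Np0 nn0 Nn0.
Qed.

Lemma weight_sqr : \sum_i \sum_j weight i j ^+ 2 =
  2 / (N * n)%:R + (2 * N * N.-1)%:R^-1.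
Proof.
have offX (i : 'I_N) c :
    \sum_(j < N) (if j == i then 0 else c) ^+ 2 = N.-1%:R * c ^+ 2 :> R.
  rewrite -(sum_offdiag i); apply: eq_bigr => j _.
  by case: eqP => // _; rewrite expr0n.
have zeroX k : \sum_(j < k) 0 ^+ 2 = 0 :> R by rewrite big1 // => j _; rewrite expr0n.
rewrite !big_sumType /= [X in _ + X]big1 ?addr0; last first.
  by move=> i _; rewrite !big_sumType /= !zeroX !addr0.
under eq_bigr do rewrite !big_sumType /= zeroX offX sum_cst.
under [X in _ + X]eq_bigr do rewrite !big_sumType /= zeroX offX sum_cst.
rewrite !sum_cst !natrM.
by field; rewrite Np0 nn0 Nn0.
Qed.

(** An index of X or Y has total weight [1 / N] towards Z and [1 / N] inside its own sample, hence
    [2N (2 / N) ^ 2]; an index of Z has total weight [2 / n], hence [n (2 / n) ^ 2]. *)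
Lemma weight_rows :
  \sum_i (\sum_j (`|weight i j| + `|weight j i|)) ^+ 2 = 8 / N%:R + 4 / n%:R.
Proof.
have offN (i : 'I_N) (c : R) :
    \sum_(j < N) (`|if j == i then 0 else c| + `|if i == j then 0 else c|) =
    N.-1%:R * (2 * `|c|) :> R.
  rewrite -(sum_offdiag i); apply: eq_bigr => j _.
  by rewrite [i == j]eq_sym; case: eqP => // _; rewrite ?normr0 ?addr0 //; ring.
have zeroN k : \sum_(j < k) (`|0 : R| + `|0 : R|) = 0.
  by rewrite big1 // => j _; rewrite normr0 addr0.
have absV k : `|k%:R^-1| = k%:R^-1 :> R by rewrite ger0_norm // invr_ge0.
rewrite !big_sumType /=.
under eq_bigr do rewrite !big_sumType /= zeroN offN sum_cst.
under [X in _ + X + _]eq_bigr do rewrite !big_sumType /= zeroN offN sum_cst.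
under [X in _ + X]eq_bigr do rewrite !big_sumType /= zeroN !sum_cst.
rewrite !normrN !absV !normr0 !sum_cst !natrM.
by field; rewrite Np0 nn0 Nn0.
Qed.

Definition collision_test (x y : {ffun 'I_N -> A}) (z : {ffun 'I_n -> A}) : bool :=
  meet_stat weight (join_samples x y z) <= 0.

(** Variance bound over squared distance to the threshold, where [k] bounds the letter probabilities
    and [d] is a lower bound of [|p - q|^2]. *)
Definition error_bound (k d : R) : R :=
  (2 * k * (2 / (N * n)%:R + (2 * N * N.-1)%:R^-1) +
   k ^+ 2 * (8 / N%:R + 4 / n%:R)) / (d / 2) ^+ 2.

(** Both kinds of error are treated at once, [b] being the wrong answer. The mean of the statistic
    is half of [|p - q|^2] up to sign and the threshold is 0, so a wrong answer forces a deviation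
    of at least [d / 2]. *)
Lemma collision_test_error (p q r : A -> R) (k d : R) (b : bool) :
  (forall a, 0 <= p a) -> \sum_a p a = 1 -> (forall a, p a <= k) ->
  (forall a, 0 <= q a) -> \sum_a q a = 1 -> (forall a, q a <= k) ->
  0 <= k -> 0 < d -> d <= \sum_a (p a - q a) ^+ 2 ->
  r =1 (if b then p else q) ->
  \sum_x \sum_y \sum_z (collision_test x y z == b)%:R *
    ((\prod_i p (x i)) * (\prod_i q (y i)) * (\prod_i r (z i))) <= error_bound k d.
Proof.
move=> p0 p1 pk q0 q1 qk k0 d0 dD rE.
pose law := sample_law p q r.
have law0 i a : 0 <= law i a by case: i => [[]|] i //=; rewrite rE; case: b {rE}.
have lawk i a : law i a <= k by case: i => [[]|] i //=; rewrite rE; case: b {rE}.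
have law1 i : \sum_a law i a = 1.
  by case: i => [[]|] i //=; under eq_bigr do rewrite rE; case: b {rE}.
pose S := @meet_stat R index A weight.
rewrite (expect_join p q r (fun w => ((S w <= 0) == b)%:R)) -/law.
pose e := expect law S.
have eE : e = (if b then 1 else -1) * (\sum_a (p a - q a) ^+ 2) / 2.
  rewrite /e /S (expect_meet_stat law1 weight_diag) expect_stat.
  rewrite -sumrB mulr_suml -sumrB mulr_sumr mulr_suml; apply: eq_bigr => a _.
  by rewrite rE; case: (b); field.
have gap w : ((S w <= 0) == b)%:R * (d / 2) ^+ 2 <= (S w - e) ^+ 2.
  have [Sb|_] := eqVneq (S w <= 0) b; last by rewrite mul0r sqr_ge0.
  rewrite mul1r eE; set D := \sum_a _ in dD *.
  case: b Sb {eE rE} => [|/negbT]; rewrite ?mul1r ?mulN1r -?ltNge => Sb.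
    by rewrite -[leRHS]sqrrN lerXn2r ?nnegrE; lra.
  by rewrite lerXn2r ?nnegrE; lra.
rewrite /error_bound ler_pdivlMr ?exprn_gt0 ?divr_gt0 //.
rewrite mulrC -expectZ -weight_sqr -weight_rows.
apply: le_trans (variance_meet_stat law0 law1 k0 lawk weight_diag).
by apply: expect_le => // w; rewrite mulrC.
Qed.

End CollisionClassifier.

(** Cauchy-Schwarz, from the nonnegativity of the sum of squared deviations of [|x j|] from their
    mean. *)
Lemma sum_sqr_ge (R : realFieldType) (m : nat) (x : 'I_m -> R) :
  (\sum_j `|x j|) ^+ 2 / m%:R <= \sum_j x j ^+ 2.
Proof.
case: m x => [|m] x; first by rewrite invr0 mulr0 big_ord0.
set s : R := \sum_j _; have m0 : 0 < m.+1%:R :> R by rewrite ltr0n.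
have : 0 <= \sum_j (`|x j| - s / m.+1%:R) ^+ 2 by apply: sumr_ge0 => j _; exact: sqr_ge0.
have -> : \sum_j (`|x j| - s / m.+1%:R) ^+ 2 = \sum_j x j ^+ 2 - s ^+ 2 / m.+1%:R.
  transitivity (\sum_j (x j ^+ 2 + (- (2 * s / m.+1%:R) * `|x j| + (s / m.+1%:R) ^+ 2))).
    by apply: eq_bigr => j _; rewrite -[x j ^+ 2]real_normK ?num_real //; ring.
  rewrite !big_split /= -mulr_sumr -/s sum_cst.
  by field; rewrite nat1r gt_eqF.
by rewrite subr_ge0.
Qed.

(** * Achievability *)

Section WorstCaseError.
Variables (R : realType) (eps cbar : R) (m N n : nat).
Variable phi : word m N -> word m N -> word m n -> bool.

Lemma prob_outE (pi mu nu : 'I_m -> R) (b : bool) :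
  prob_out phi pi mu nu b =
  expect (sample_law pi mu nu) (fun w =>
    (phi [ffun i => w (inl (inl i))] [ffun i => w (inl (inr i))]
         [ffun i => w (inr i)] == b)%:R).
Proof.
rewrite -expect_join; apply: eq_bigr => x _; apply: eq_bigr => y _.
apply: eq_bigr => z _; congr ((phi _ _ _ == b)%:R * _);
  by apply/ffunP => i; rewrite !ffunE.
Qed.

Lemma prob_out_itv (pi mu nu : 'I_m -> R) (b : bool) :
  is_distr pi -> is_distr mu -> is_distr nu ->
  0 <= prob_out phi pi mu nu b <= 1.
Proof.
move=> [p0 p1] [q0 q1] [r0 r1]; rewrite prob_outE.
have law0 (i : 'I_N + 'I_N + 'I_n) a : 0 <= sample_law pi mu nu i a.
  by case: i => [[]|].
have law1 (i : 'I_N + 'I_N + 'I_n) : \sum_a sample_law pi mu nu i a = 1.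
  by case: i => [[]|].
rewrite expect_ge0 //= -[leRHS](expect1 law1); apply: expect_le => // w.
by case: eqP.
Qed.

(** The average errors are bounded by 1, so that [sup] is a genuine upper bound. *)
Lemma Perr_ge (pi mu : 'I_m -> R) : admissible eps cbar pi mu ->
  2^-1 * prob_out phi pi mu pi true + 2^-1 * prob_out phi pi mu mu false <=
  Perr eps cbar phi.
Proof.
move=> adm; apply: ub_le_sup; last by exists pi, mu.
exists 1 => _ [p [q [[dp dq _ _ _] ->]]].
have /andP[_] := prob_out_itv true dp dq dp.
have /andP[_] := prob_out_itv false dp dq dq.
by lra.
Qed.

(** If no pair is admissible, [sup] takes its default value 0, whence the condition [0 <= d]. *)
Lemma Perr_le (d : R) : 0 <= d ->
  (forall pi mu : 'I_m -> R, admissible eps cbar pi mu ->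
    prob_out phi pi mu pi true <= d /\ prob_out phi pi mu mu false <= d) ->
  Perr eps cbar phi <= d.
Proof.
move=> d0 le_d; rewrite /Perr; set E := [set e | _].
have [->|/set0P[e Ee]] := eqVneq E set0; first by rewrite sup0.
apply: ge_sup; first by exists e.
by move=> _ [p [q [/le_d[] + + ->]]]; lra.
Qed.
End WorstCaseError.

Lemma Perr_ge0 (R : realType) (eps cbar : R) (m N n : nat)
  (phi : word m N -> word m N -> word m n -> bool) : 0 <= Perr eps cbar phi.
Proof.
rewrite {1}/Perr; set E := [set e | _].
have [->|/set0P[_ [p [q [adm _]]]]] := eqVneq E set0; first by rewrite sup0.
apply: le_trans (Perr_ge phi adm); have [dp dq _ _ _] := adm.
have /andP[+ _] := prob_out_itv phi true dp dq dp.
have /andP[+ _] := prob_out_itv phi false dp dq dq.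
by lra.
Qed.

Section Achievability.
Variable R : realType.

Lemma Perr_collision_test (eps cbar : R) (m N n : nat) :
  0 < eps -> 0 <= cbar -> (0 < m)%N -> (1 < N)%N -> (0 < n)%N ->
  Perr eps cbar (@collision_test R 'I_m N n) <=
  error_bound N n (cbar / m%:R) (eps ^+ 2 / m%:R).
Proof.
move=> eps0 c0 m0 N1 n0.
have k0 : 0 <= cbar / m%:R by rewrite divr_ge0.
have d0 : 0 < eps ^+ 2 / m%:R by rewrite divr_gt0 ?exprn_gt0 ?ltr0n.
apply: Perr_le => [|p q [[p0 p1] [q0 q1] pq pk qk]].
  rewrite /error_bound divr_ge0 ?sqr_ge0 //.
  by do ?[exact: k0 | exact: ler0n | rewrite addr_ge0 | rewrite mulr_ge0 |
    rewrite divr_ge0 | rewrite sqr_ge0 | rewrite invr_ge0].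
have dD : eps ^+ 2 / m%:R <= \sum_a (p a - q a) ^+ 2.
  apply: le_trans (sum_sqr_ge _); rewrite ler_wpM2r ?invr_ge0 //.
  rewrite lerXn2r ?nnegrE ?sumr_ge0 ?(ltW eps0) //; apply: le_trans pq _.
  by apply: ler_sum => j _; rewrite distrC.
by split; apply: collision_test_error.
Qed.

(** Division by [(eps ^+ 2 / (2 m)) ^ 2] brings a factor [m ^ 2], which leaves [m / (N n)] twice and
    [m / (2 N (N - 1))] once; each is at most the rate, hence the constant [6 = 2 * 3]. *)
Lemma error_bound_le (eps cbar : R) (m N n : nat) :
  0 < eps -> 0 <= cbar -> (0 < m)%N -> (1 < N)%N -> (0 < n)%N ->
  error_bound N n (cbar / m%:R) (eps ^+ 2 / m%:R) <=
  4 / eps ^+ 4 * (6 * cbar * (m%:R / (minn (N ^ 2) (N * n))%:R) +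
    cbar ^+ 2 * (8 * N%:R^-1 + 4 * n%:R^-1)).
Proof.
move=> eps0 c0 m0 N1 n0.
set r := m%:R / _.
have mR : 0 < m%:R :> R by rewrite ltr0n.
have N0 : (0 < N)%N by apply: ltnW.
have min0 : (0 < minn (N ^ 2) (N * n))%N by rewrite leq_min expn_gt0 muln_gt0 N0 n0.
have rNn : m%:R / (N * n)%:R <= r.
  by rewrite ler_wpM2l // lef_pV2 ?posrE ?ltr0n ?muln_gt0 ?N0 // ler_nat geq_minr.
(* This amounts to [N ^ 2 <= 2 N (N - 1)], valid from [N = 2] on. *)
have rN : m%:R / (2 * N * N.-1)%:R <= r.
  rewrite ler_wpM2l // lef_pV2 ?posrE ?ltr0n ?muln_gt0 ?N0 //=; last first.
    by case: N N1 {N0 min0 rNn r} => [|[]].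
  rewrite ler_nat (leq_trans (geq_minl _ _)) //.
  rewrite -mulnn [(2 * N)%N]mulnC -mulnA leq_mul2l.
  case: N N1 {N0 min0 rNn r} => [|[|N']] // _.
  by rewrite orFb mul2n -addnn /= addnS addSn !ltnS leq_addr.
rewrite [leLHS](_ : _ = 4 / eps ^+ 4 * (2 * cbar * (2 * (m%:R / (N * n)%:R) +
    m%:R / (2 * N * N.-1)%:R) + cbar ^+ 2 * (8 * N%:R^-1 + 4 * n%:R^-1))).
  apply: ler_wpM2l; first by rewrite divr_ge0 ?exprn_ge0 // ltW.
  rewrite lerD2r -!mulrA; have := ler_wpM2l c0 rNn; have := ler_wpM2l c0 rN.
  lra.
rewrite /error_bound.
set u := (N * n)%:R^-1; set v := (_ * _)%:R^-1.
by field; rewrite !pnatr_eq0 -!lt0n n0 N0 m0 gt_eqF.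
Qed.

Lemma cvg_inv_tends_to_infty (f : nat -> nat) : tends_to_infty f ->
  (fun m => (f m)%:R^-1 : R) @ \oo --> (0 : R).
Proof.
move=> finf; apply/cvgrPdist_le => e e0.
have [M fM] := finf (Num.truncn e^-1).+1.
exists M => // m /= /fM {}fM; rewrite sub0r normrN ger0_norm ?invr_ge0 //.
have lt_f : e^-1 < (f m)%:R by apply: lt_le_trans (truncnS_gt _) _; rewrite ler_nat.
by rewrite -[leRHS]invrK lef_pV2 ?posrE ?invr_gt0 // ?ltW // (lt_trans _ lt_f) ?invr_gt0.
Qed.

Lemma collision_test_consistent (eps cbar : R) (N n : nat -> nat) :
  0 < eps -> 0 <= cbar -> tends_to_infty N -> tends_to_infty n ->
  (fun m => m%:R / (minn (N m ^ 2) (N m * n m))%:R : R) @ \oo --> (0 : R) ->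
  asympt_consistent eps cbar (fun m => @collision_test R 'I_m (N m) (n m)).
Proof.
move=> eps0 c0 Ninf ninf rate.
pose bound m : R := 4 / eps ^+ 4 * (6 * cbar * (m%:R / (minn (N m ^ 2) (N m * n m))%:R) +
    cbar ^+ 2 * (8 * (N m)%:R^-1 + 4 * (n m)%:R^-1)).
have bound0 : bound @ \oo --> (0 : R).
  have -> : 0 = 4 / eps ^+ 4 * (6 * cbar * 0 + cbar ^+ 2 * (8 * 0 + 4 * 0)) :> R.
    by rewrite !(mulr0, addr0).
  have cN := cvg_inv_tends_to_infty Ninf; have cn := cvg_inv_tends_to_infty ninf.
  apply: cvgM; first exact: cvg_cst.
  apply: cvgD; first by apply: cvgM => //; exact: cvg_cst.
  apply: cvgM; first exact: cvg_cst.
  by apply: cvgD; apply: cvgM => //; exact: cvg_cst.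
apply: (@squeeze_cvgr _ _ _ _ (fun=> 0) bound) => //; last exact: cvg_cst.
have [M1 NM] := Ninf 2; have [M2 nM] := ninf 1.
exists (maxn 1 (maxn M1 M2)) => // m /=; rewrite !geq_max => /and3P[m0 /NM N1 /nM n0].
rewrite Perr_ge0 /=; apply: le_trans (error_bound_le eps0 c0 m0 N1 n0).
exact: Perr_collision_test.
Qed.
End Achievability.

(** * Averages and pushforwards of uniform laws *)

Section Average.
Variable R : realFieldType.

(** Over an empty type the value is 0, which is why [avg_cst] asks for an inhabitant. *)
Definition avg (T : finType) (f : T -> R) : R := (\sum_t f t) / #|T|%:R.

Lemma eq_avg (T : finType) (f g : T -> R) : f =1 g -> avg f = avg g.
Proof. by move=> fg; rewrite /avg; under eq_bigr do rewrite fg. Qed.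

Lemma avg_le (T : finType) (f g : T -> R) :
  (forall t, f t <= g t) -> avg f <= avg g.
Proof. by move=> fg; rewrite ler_wpM2r ?invr_ge0 // ler_sum. Qed.

Lemma avg_ge0 (T : finType) (f : T -> R) : (forall t, 0 <= f t) -> 0 <= avg f.
Proof. by move=> f0; rewrite divr_ge0 // sumr_ge0. Qed.

Lemma avgD (T : finType) (f g : T -> R) :
  avg (fun t => f t + g t) = avg f + avg g.
Proof. by rewrite /avg big_split mulrDl. Qed.

Lemma avgZ (T : finType) c (f : T -> R) : avg (fun t => c * f t) = c * avg f.
Proof. by rewrite /avg -mulr_sumr mulrA. Qed.

Lemma avg_cst (T : finType) (t : T) c : avg (fun _ : T => c) = c.
Proof.
rewrite /avg sumr_const -[c *+ _]mulr_natr mulfK // pnatr_eq0 -lt0n.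
by apply/card_gt0P; exists t.
Qed.

Lemma exchange_avg (S T : finType) (f : S -> T -> R) :
  avg (fun s => avg (f s)) = avg (fun t => avg (f^~ t)).
Proof. by rewrite /avg -!mulr_suml exchange_big mulrAC. Qed.

Lemma avg_bij (S T : finType) (h : S -> T) (f : T -> R) :
  bijective h -> avg f = avg (fun s => f (h s)).
Proof.
move=> bh; rewrite /avg (bij_eq_card bh); congr (_ / _).
by rewrite (reindex h) //; exact: onW_bij.
Qed.

Lemma avg_pair (S T : finType) (f : S * T -> R) :
  avg f = avg (fun s => avg (fun t => f (s, t))).
Proof.
rewrite /avg -mulr_suml pair_big /= card_prod natrM invfM mulrA mulrAC.
by congr (_ / _ / _); apply: eq_bigr => -[].
Qed.

Definition zip_ffun (I : finType) (S T : Type) (s : {ffun I -> S})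
    (t : {ffun I -> T}) :
  {ffun I -> S * T} := [ffun i => (s i, t i)].

Lemma avg_zip (I S T : finType) (f : {ffun I -> S * T} -> R) :
  avg f = avg (fun s => avg (fun t => f (zip_ffun s t))).
Proof.
rewrite (avg_bij (h := fun u => zip_ffun u.1 u.2)) ?avg_pair //.
exists (fun w : {ffun I -> S * T} => ([ffun i => (w i).1], [ffun i => (w i).2])).
  by move=> [s t]; congr (_, _); apply/ffunP => i; rewrite !ffunE.
by move=> w; apply/ffunP => i; rewrite !ffunE; case: (w i).
Qed.

(** The values of a uniform function at distinct points are uniform. A shift [t] of these values
    extends to a shift of [s], so an average over [t] can be inserted; for fixed [s] it is then an
    average over all words. *)
Lemma avg_comp_inj (I X : finType) (c : nat) (b : {ffun I -> X})
    (f : {ffun I -> 'I_c.+1} -> R) : injective b ->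
  avg (fun s : {ffun X -> 'I_c.+1} => f [ffun i => s (b i)]) = avg f.
Proof.
move=> b_inj.
pose lift (t : {ffun I -> 'I_c.+1}) : {ffun X -> 'I_c.+1} :=
  [ffun x => if [pick i | b i == x] is Some i then t i else 0].
have liftE t i : lift t (b i) = t i.
  rewrite ffunE; case: pickP => [j /eqP/b_inj -> //|/(_ i)]; by rewrite eqxx.
transitivity (avg (fun t => avg (fun s : {ffun X -> 'I_c.+1} =>
    f ([ffun i => s (b i)] + t)))).
  rewrite -[LHS](avg_cst ([ffun=> 0] : {ffun I -> 'I_c.+1})); apply: eq_avg => t.
  rewrite (avg_bij (h := fun s : {ffun X -> 'I_c.+1} => s + lift t)); last first.
    by exists (fun s : {ffun X -> 'I_c.+1} => s - lift t) => s; rewrite ?addrK ?subrK.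
  apply: eq_avg => s; congr f; apply/ffunP => i.
  by rewrite !ffunE -[in RHS]liftE ffunE.
rewrite exchange_avg -[RHS](avg_cst ([ffun=> 0] : {ffun X -> 'I_c.+1})).
by apply: eq_avg => s; rewrite [RHS](avg_bij (h := fun t => [ffun i => s (b i)] + t)) //.
Qed.

(** Birthday estimate: injective words number [B ^_ N], a product of [N] factors each at least
    [B - N]. *)
Lemma avg_injective_ge (B N : nat) : (0 < B)%N -> (N <= B)%N ->
  (1 - N%:R / B%:R) ^+ N <=
  avg (fun b : {ffun 'I_N -> 'I_B} => (injectiveb b)%:R).
Proof.
move=> B0 NB.
have B0R : B%:R != 0 :> R by rewrite pnatr_eq0 -lt0n.
rewrite /avg card_ffun !card_ord -natr_sum.
have -> : (\sum_(b : {ffun 'I_N -> 'I_B}) injectiveb b = B ^_ N)%N.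
  rewrite -[N in RHS]card_ord -[B in RHS]card_ord -card_inj_ffuns -sum1dep_card.
  by rewrite [RHS]big_mkcond; apply: eq_bigr => b _; case: injectiveb.
have -> : 1 - N%:R / B%:R = (B - N)%:R / B%:R :> R.
  by rewrite natrB // mulrBl divff.
rewrite expr_div_n natrX ler_wpM2r ?invr_ge0 ?exprn_ge0 // -natrX ler_nat.
rewrite ffact_prod -[X in (_ ^ X)%N](card_ord N) -prod_nat_const.
by apply: leq_prod => i _; rewrite leq_sub2l // ltnW.
Qed.

Lemma avg_avoid_ge (B n k : nat) (S : {set 'I_B}) :
  (0 < B)%N -> (#|S| <= k)%N -> (k <= B)%N ->
  (1 - k%:R / B%:R) ^+ n <=
  avg (fun z : {ffun 'I_n -> 'I_B} => [forall i, z i \notin S]%:R).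
Proof.
move=> B0 Sk kB.
have B0R : B%:R != 0 :> R by rewrite pnatr_eq0 -lt0n.
rewrite /avg card_ffun !card_ord -natr_sum.
have -> : (\sum_(z : {ffun 'I_n -> 'I_B}) [forall i, z i \notin S] = (B - #|S|) ^ n)%N.
  have -> : (B - #|S|)%N = #|~: S| by rewrite [RHS]cardsCs finset.setCK card_ord.
  rewrite -[n in RHS]card_ord -card_ffun_on -sum1_card [RHS]big_mkcond.
  apply: eq_bigr => z _; rewrite (_ : _ \in _ = [forall i, z i \notin S]).
    by case: ifP.
  by apply/ffun_onP/forallP => zS i; have := zS i; rewrite inE.
have -> : 1 - k%:R / B%:R = (B - k)%:R / B%:R :> R.
  by rewrite natrB // mulrBl divff.
rewrite expr_div_n !natrX ler_wpM2r ?invr_ge0 ?exprn_ge0 //.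
by rewrite lerXn2r ?nnegrE // ler_nat leq_sub2l.
Qed.
End Average.

Section Pushforward.
Variables (R : realType) (m : nat).

(** The laws of the converse are all images of uniform laws, so that error probabilities become
    averages on which bijections act. *)
Definition push (T : finType) (g : T -> 'I_m) (j : 'I_m) : R :=
  avg (fun t => (g t == j)%:R).

Definition map_word (k : nat) (T : finType) (g : T -> 'I_m) (t : {ffun 'I_k -> T}) :
  word m k := [ffun i => g (t i)].

Lemma sum_push (T : finType) (g : T -> 'I_m) (h : 'I_m -> R) :
  \sum_j push g j * h j = avg (fun t => h (g t)).
Proof.
rewrite /push /avg; under eq_bigr do rewrite mulrAC mulr_suml.
rewrite -mulr_suml exchange_big; congr (_ / _); apply: eq_bigr => t _.
rewrite (bigD1 (g t)) //= eqxx mul1r big1 ?addr0 // => j.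
by rewrite eq_sym => /negPf ->; rewrite mul0r.
Qed.

Lemma push_distr (T : finType) (g : T -> 'I_m) (t : T) : is_distr (push g).
Proof.
split=> [j|]; first exact: avg_ge0.
by under eq_bigr do rewrite -[push g _]mulr1; rewrite (sum_push g (fun=> 1)) avg_cst.
Qed.

Lemma push_le (T : finType) (g : T -> 'I_m) j : injective g -> push g j <= #|T|%:R^-1.
Proof.
move=> g_inj; rewrite -[leRHS]mul1r ler_wpM2r ?invr_ge0 //.
have [t /eqP gt|none] := pickP (fun t => g t == j).
  rewrite (bigD1 t) //= big1 ?addr0 => [|s st]; first by case: eqP.
  by rewrite -gt (inj_eq g_inj) (negPf st).
by rewrite big1 // => t _; rewrite none.
Qed.

Lemma l1distC (p q : 'I_m -> R) : l1dist p q = l1dist q p.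
Proof. by apply: eq_bigr => j _; rewrite distrC. Qed.

(** Duality: the difference of the laws is tested against the function equal to 1 on the range of
    [g] and to -1 elsewhere. *)
Lemma l1dist_push_ge (S T : finType) (f : S -> 'I_m) (g : T -> 'I_m) (t : T) :
  1 - avg (fun s => (-1) ^+ (f s \notin codom g)) <= l1dist (push f) (push g).
Proof.
pose h j : R := (-1) ^+ (j \notin codom g).
have hg1 : 1 = avg (fun t => h (g t)).
  by rewrite -[LHS](avg_cst t (1 : R)); apply: eq_avg => u; rewrite /h codom_f.
rewrite [X in X - _]hg1 -[X in _ - X](sum_push f h) -(sum_push g h) -sumrB.
apply: ler_sum => j _; rewrite -mulrBl; apply: le_trans (ler_norm _) _.
by rewrite normrM /h normrX normrN1 expr1n mulr1.
Qed.

Lemma sum_word_push (k : nat) (T : finType) (g : T -> 'I_m) (f : word m k -> R) :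
  \sum_(x : word m k) f x * word_prob (push g) x = avg (fun t => f (map_word g t)).
Proof.
rewrite /avg card_ffun card_ord natrX.
have word_pushE (x : word m k) : word_prob (push g) x =
    (\sum_(t : {ffun 'I_k -> T}) (map_word g t == x)%:R) / #|T|%:R ^+ k.
  rewrite /word_prob big_split /= prodr_const card_ord exprVn; congr (_ / _).
  rewrite bigA_distr_bigA; apply: eq_bigr => t _.
  have [tx|/eqP tx] := eqVneq (map_word g t) x.
    by rewrite big1 // => i _; rewrite -tx ffunE eqxx.
  have [i ti] : exists i, g (t i) != x i.
    apply/existsP; apply: contra_notT tx; rewrite negb_exists => /forallP tx.
    by apply/ffunP => i; rewrite ffunE; apply/eqP; rewrite -[_ == _]negbK tx.
  by rewrite (bigD1 i) //= (negPf ti) mul0r.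
under eq_bigr do rewrite word_pushE mulrA mulr_sumr.
rewrite -mulr_suml exchange_big; congr (_ / _); apply: eq_bigr => t _.
rewrite (bigD1 (map_word g t)) //= eqxx mulr1 big1 ?addr0 // => x.
by rewrite eq_sym => /negPf ->; rewrite mulr0.
Qed.

Lemma prob_out_push (N n : nat) (phi : word m N -> word m N -> word m n -> bool)
    (S T U : finType) (f : S -> 'I_m) (g : T -> 'I_m) (h : U -> 'I_m) (b : bool) :
  prob_out phi (push f) (push g) (push h) b =
  avg (fun x => avg (fun y => avg (fun z =>
    (phi (map_word f x) (map_word g y) (map_word h z) == b)%:R))).
Proof.
rewrite /prob_out -(sum_word_push f (fun x => avg (fun y => avg (fun z =>
    (phi x (map_word g y) (map_word h z) == b)%:R)))).
apply: eq_bigr => x _.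
rewrite -(sum_word_push g (fun y => avg (fun z => (phi x y (map_word h z) == b)%:R))).
rewrite mulr_suml; apply: eq_bigr => y _.
rewrite -(sum_word_push h (fun z => (phi x y z == b)%:R)) !mulr_suml.
by apply: eq_bigr => z _; ring.
Qed.
End Pushforward.

(** * Converse *)

Section LowerBounds.
Variables (R : realType) (eps cbar : R) (m N n B : nat).
Variable phi : word m N -> word m N -> word m n -> bool.
Hypothesis B_gt0 : (0 < B)%N.
Hypothesis B_large : B%:R^-1 <= cbar / m%:R.

Let b0 : 'I_B := Ordinal B_gt0.

(* If no block of z is a block of x or y, flipping s on the blocks of z is a
   bijection which exchanges the two hypotheses. *)
Lemma Perr_ge_avoid (f : 'I_B * bool -> 'I_m) :
  injective f -> (2 * N <= B)%N -> eps <= 2 ->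
  (1 - (2 * N)%:R / B%:R) ^+ n / 2 <= Perr eps cbar phi.
Proof.
move=> f_inj NB eps2.
pose G (s : {ffun 'I_B -> bool}) b := f (b, s b).
pose neg (s : {ffun 'I_B -> bool}) : {ffun 'I_B -> bool} := [ffun b => ~~ s b].
have G_inj s : injective (G s) by move=> b b' /f_inj[].
have adm s : admissible eps cbar (push R (G s)) (push R (G (neg s))).
  split; [exact: (push_distr _ _ b0)|exact: (push_distr _ _ b0)| | |].
  (* The two supports are disjoint, so the test sign is always -1 and the distance is at least 2. *)
  - apply: le_trans (l1dist_push_ge _ _ _ b0).
    rewrite (eq_avg (g := fun=> - 1)) => [|b].
      by rewrite (avg_cst b0); lra.
    rewrite (_ : _ \notin _); first by rewrite expr1.
    apply/codomP => -[b' /f_inj[<-]]; rewrite ffunE; by case: (s b).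
  - move=> j; apply: le_trans (push_le _ _ (G_inj s)) _; by rewrite card_ord.
  - move=> j; apply: le_trans (push_le _ _ (G_inj (neg s))) _; by rewrite card_ord.
pose H x y z s : R :=
  (phi (map_word (G s) x) (map_word (G (neg s)) y) (map_word (G s) z) == true)%:R +
  (phi (map_word (G s) x) (map_word (G (neg s)) y) (map_word (G (neg s)) z) == false)%:R.
have H_le s : avg (fun x => avg (fun y => avg (fun z => H x y z s))) <=
    2 * Perr eps cbar phi.
  have := Perr_ge phi (adm s); rewrite !prob_out_push -!mulrDr.
  rewrite -avgD; under eq_avg do rewrite -avgD.
  under eq_avg do under eq_avg do rewrite -avgD.
  by rewrite /H; lra.
have avgH : avg (fun x => avg (fun y => avg (fun z => avg (H x y z)))) <=
    2 * Perr eps cbar phi.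
  rewrite -[leRHS](avg_cst ([ffun=> true] : {ffun 'I_B -> bool})).
  under eq_avg do under eq_avg do rewrite exchange_avg.
  under eq_avg do rewrite exchange_avg.
  by rewrite exchange_avg; apply: avg_le.
suff : (1 - (2 * N)%:R / B%:R) ^+ n <=
    avg (fun x => avg (fun y => avg (fun z => avg (H x y z)))) by lra.
rewrite -[leLHS](avg_cst ([ffun=> b0] : {ffun 'I_N -> 'I_B})); apply: avg_le => x.
rewrite -[leLHS](avg_cst ([ffun=> b0] : {ffun 'I_N -> 'I_B})); apply: avg_le => y.
pose S := [set x i | i : 'I_N] :|: [set y i | i : 'I_N].
have S_le : (#|S| <= 2 * N)%N.
  rewrite cardsU mul2n -addnn (leq_trans (leq_subr _ _)) // leq_add //;
    by rewrite (leq_trans (leq_imset_card _ _)) // card_ord.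
apply: le_trans (avg_avoid_ge _ n B_gt0 S_le NB) _; apply: avg_le => z.
case: forallP => [zS|_]; last first.
  by rewrite avg_ge0 // => s; rewrite addr_ge0.
pose flip (s : {ffun 'I_B -> bool}) : {ffun 'I_B -> bool} :=
  [ffun b => if b \in S then s b else ~~ s b].
have flipK : involutive flip.
  by move=> s; apply/ffunP => b; rewrite !ffunE; case: (b \in S); rewrite ?negbK.
have xS i : x i \in S by rewrite inE imset_f.
have yS i : y i \in S by rewrite inE orbC imset_f.
(* Only the null term is flipped. It then shows the same three words as the alternative term, and
   the two error indicators add up to 1. *)
rewrite avgD (avg_bij _ (inv_bij flipK)) -avgD.
rewrite -[leLHS](avg_cst ([ffun=> true] : {ffun 'I_B -> bool})); apply: avg_le => s.
have -> : map_word (G (flip s)) x = map_word (G s) x.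
  by apply/ffunP => i; rewrite !ffunE /G ffunE xS.
have -> : map_word (G (neg (flip s))) y = map_word (G (neg s)) y.
  by apply/ffunP => i; rewrite !ffunE /G !ffunE yS.
have -> : map_word (G (flip s)) z = map_word (G (neg s)) z.
  by apply/ffunP => i; rewrite !ffunE /G !ffunE (negPf (zS i)).
by case: (phi _ _ _); rewrite /= ?addr0 ?add0r.
Qed.

Lemma zip_injectiveb (S T : eqType) (k : nat) (s : {ffun 'I_k -> S})
    (t : {ffun 'I_k -> T}) :
  injectiveb (fun i => (zip_ffun s t i).1) = injectiveb s.
Proof. by congr uniq; apply: eq_map => i; rewrite ffunE. Qed.

(** For injective blocks [b], the choices [s (b i)] are uniform by [avg_comp_inj], so both sides
    compare the same average; otherwise the left side vanishes. *)
Lemma avg_coupling (c : nat) (F : {ffun 'I_N -> 'I_B * 'I_c.+1} -> R) :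
  (forall v, 0 <= F v) ->
  avg (fun v : {ffun 'I_N -> 'I_B * 'I_c.+1} =>
    (injectiveb (fun i => (v i).1))%:R * F v) <=
  avg (fun s : {ffun 'I_B -> 'I_c.+1} => avg (fun b : {ffun 'I_N -> 'I_B} =>
    F (zip_ffun b [ffun i => s (b i)]))).
Proof.
move=> F0; rewrite exchange_avg avg_zip; apply: avg_le => b.
case: (injectiveP b) => [b_inj|b_ninj].
  rewrite (avg_comp_inj (fun t => F (zip_ffun b t)) b_inj).
  by apply: avg_le => t; rewrite ler_piMl // lern1 leq_b1.
rewrite (eq_avg (g := fun=> 0)) => [|t].
  by rewrite [leLHS]/avg big1 ?mul0r // avg_ge0.
by rewrite zip_injectiveb; case: injectiveP => //; rewrite mul0r.
Qed.

(* Given distinct blocks, a sample of a law supported on a random transversal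
   of the blocks is distributed as a uniform sample. *)
Lemma Perr_ge_birthday (c : nat) (f : 'I_B * 'I_c.+1 -> 'I_m) :
  injective f -> (N <= B)%N -> eps <= 2 - 2 / c.+1%:R ->
  ((1 - N%:R / B%:R) ^+ N) ^+ 2 / 4 <= Perr eps cbar phi.
Proof.
move=> f_inj NB eps_le.
pose G (s : {ffun 'I_B -> 'I_c.+1}) b := f (b, s b).
have G_inj s : injective (G s) by move=> b b' /f_inj[].
have G_map s b : map_word (G s) b = map_word f (zip_ffun b [ffun i => s (b i)]).
  by apply/ffunP => i; rewrite !ffunE.
(* A uniform letter is chosen by [s] with probability [1 / c.+1], so the mean of the test sign is
   [2 / c.+1 - 1]. *)
have far s : eps <= l1dist (push R f) (push R (G s)).
  apply: le_trans (l1dist_push_ge _ _ _ b0); apply: (le_trans eps_le).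
  rewrite avg_pair (eq_avg (g := fun=> 2 / c.+1%:R - 1)) => [|b].
    by rewrite (avg_cst b0); move: (2 / c.+1%:R) => q; lra.
  rewrite (eq_avg (g := fun t => 2 * (t == s b)%:R + -1)) => [|t].
    rewrite avgD (avg_cst ord0) avgZ; congr (_ * _ - 1).
    rewrite /avg card_ord (bigD1 (s b)) //= eqxx big1 ?addr0 ?div1r //.
    by move=> t /negPf ->.
  have [->|ts] := eqVneq t (s b).
    by rewrite (codom_f (G s) b) expr0 mulr1n; lra.
  rewrite (_ : _ \notin _); first by rewrite expr1 mulr0n; lra.
  by apply/codomP => -[b' /f_inj[<-]]; apply/eqP.
have lef j : push R f j <= cbar / m%:R.
  apply: le_trans (push_le _ _ f_inj) (le_trans _ B_large).
  rewrite card_prod !card_ord lef_pV2 ?posrE ?ltr0n ?muln_gt0 ?B_gt0 //.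
  by rewrite ler_nat leq_pmulr.
have leG s j : push R (G s) j <= cbar / m%:R.
  by apply: le_trans (push_le _ _ (G_inj s)) _; rewrite card_ord.
have df := push_distr R f (b0, ord0).
have dG s := push_distr R (G s) b0.
have adm s : admissible eps cbar (push R f) (push R (G s)) by split.
have admC s : admissible eps cbar (push R (G s)) (push R f).
  by split=> //; rewrite l1distC.
pose K (u v : {ffun 'I_N -> 'I_B * 'I_c.+1}) z b : R :=
  (phi (map_word f u) (map_word f v) (map_word f z) == b)%:R.
have K0 u v z b : 0 <= K u v z b by [].
(* [F1] is the null error for uniform X given Y, and [F0] the alternative error for uniform Y given
   X; Z is uniform in both. *)
pose F1 v := avg (fun u => avg (fun z => K u v z true)).
pose F0 u := avg (fun v => avg (fun z => K u v z false)).
pose D (v : {ffun 'I_N -> 'I_B * 'I_c.+1}) : R := (injectiveb (fun i => (v i).1))%:R.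
pose word0 : {ffun 'I_B -> 'I_c.+1} := [ffun=> ord0].
have err1 : avg (fun v => D v * F1 v) <= 2 * Perr eps cbar phi.
  apply: le_trans (avg_coupling _) _; first by move=> v; do 2 apply: avg_ge0 => ?.
  rewrite -[leRHS](avg_cst word0); apply: avg_le => s.
  have := Perr_ge phi (adm s).
  have /andP[+ _] := prob_out_itv phi false df (dG s) (dG s).
  have -> : prob_out phi (push R f) (push R (G s)) (push R f) true =
      avg (fun b => F1 (zip_ffun b [ffun i => s (b i)])).
    rewrite prob_out_push exchange_avg; apply: eq_avg => b; apply: eq_avg => u.
    by apply: eq_avg => z; rewrite G_map.
  by lra.
have err0 : avg (fun u => D u * F0 u) <= 2 * Perr eps cbar phi.
  apply: le_trans (avg_coupling _) _; first by move=> v; do 2 apply: avg_ge0 => ?.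
  rewrite -[leRHS](avg_cst word0); apply: avg_le => s.
  have := Perr_ge phi (admC s).
  have /andP[+ _] := prob_out_itv phi true (dG s) df (dG s).
  have -> : prob_out phi (push R (G s)) (push R f) (push R f) false =
      avg (fun b => F0 (zip_ffun b [ffun i => s (b i)])).
    rewrite prob_out_push; apply: eq_avg => b; apply: eq_avg => u.
    by apply: eq_avg => z; rewrite G_map.
  by lra.
have DD : avg D * avg D <= 4 * Perr eps cbar phi.
  suff : avg D * avg D <= avg (fun v => D v * F1 v) + avg (fun u => D u * F0 u) by lra.
  have -> : avg (fun v => D v * F1 v) =
      avg (fun u => avg (fun v => avg (fun z => D v * K u v z true))).
    rewrite exchange_avg; apply: eq_avg => v; rewrite -avgZ.
    by apply: eq_avg => u; rewrite -avgZ.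
  have -> : avg (fun u => D u * F0 u) =
      avg (fun u => avg (fun v => avg (fun z => D u * K u v z false))).
    apply: eq_avg => u; rewrite -avgZ.
    by apply: eq_avg => v; rewrite -avgZ.
  rewrite -avgZ -avgD; apply: avg_le => u; rewrite mulrC -avgZ -avgD.
  apply: avg_le => v; rewrite -avgD.
  rewrite -[leLHS](avg_cst ([ffun=> (b0, ord0)] : {ffun 'I_n -> 'I_B * 'I_c.+1})).
  apply: avg_le => z; rewrite /D /K.
  (* Pointwise, one of the two answers is given, so [D u * D v] is at most the sum of the two
     weighted indicators. *)
  by do 2 case: injectiveb; case: (phi _ _ _);
    rewrite ?(mulr1n, mulr0n, mulr0, mulr1, addr0, add0r) //; lra.
suff : ((1 - N%:R / B%:R) ^+ N) ^+ 2 <= avg D * avg D by lra.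
have u_le1 : N%:R / B%:R <= 1 :> R by rewrite ler_pdivrMr ?ltr0n // mul1r ler_nat.
have avgD_ge : (1 - N%:R / B%:R) ^+ N <= avg D.
  apply: (le_trans (avg_injective_ge R B_gt0 NB)).
  rewrite /D avg_zip; apply: avg_le => b.
  rewrite -[leLHS](avg_cst ([ffun=> ord0] : {ffun 'I_N -> 'I_c.+1})).
  apply: avg_le => t.
  by rewrite zip_injectiveb.
by rewrite expr2 ler_pM ?exprn_ge0 ?subr_ge0.
Qed.
End LowerBounds.

(** * From the two lower bounds to the rate *)

Section Necessity.
Variable R : realType.

Lemma exists_injection (T : finType) (m : nat) :
  (#|T| <= m)%N -> exists f : T -> 'I_m, injective f.
Proof.
move=> Tm; exists (fun t => widen_ord Tm (enum_rank t)) => s t st.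
by apply/enum_rank_inj/val_inj; exact: (congr1 val st).
Qed.

(** For [u <= 1/2] one has [1 <= (1 - u) (1 + 2 u) <= (1 - u) exp (2 u)]. *)
Lemma expR_le_expn (u : R) (k : nat) : 0 <= u <= 2^-1 ->
  expR (- (2 * (k%:R * u))) <= (1 - u) ^+ k.
Proof.
move=> /andP[u0 u2].
have -> : - (2 * (k%:R * u)) = k%:R * - (2 * u) by ring.
rewrite expRM_natl lerXn2r ?nnegrE ?expR_ge0 ?subr_ge0; try lra.
rewrite expRN -[leLHS]mul1r ler_pdivrMr ?expR_gt0 //.
apply: le_trans (_ : (1 - u) * (1 + 2 * u) <= _); first by nra.
by rewrite ler_wpM2l ?expR_ge1Dx //; lra.
Qed.

Lemma Perr_ge_const (eps cbar K : R) (m N n B c : nat)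
    (phi : word m N -> word m N -> word m n -> bool) :
  (0 < c)%N -> eps <= 2 - 2 / c.+1%:R -> (B * c.+1 <= m)%N ->
  B%:R^-1 <= cbar / m%:R -> 0 < K -> 4 * K < B%:R -> 4 * K < n%:R ->
  (minn (N ^ 2) (N * n))%:R <= K * B%:R ->
  expR (- (4 * K)) / 4 <= Perr eps cbar phi.
Proof.
move=> c0 epsc Bm BL K0 KB Kn small.
have BR0 : 0 < B%:R :> R by apply: lt_trans KB; rewrite mulr_gt0.
have B0 : (0 < B)%N by rewrite -(ltr0n R).
have c1 : 0 < 2 / c.+1%:R :> R by rewrite divr_gt0.
have e0 : 0 < expR (- (4 * K)) by exact: expR_gt0.
case: (leqP (N ^ 2) (N * n)) small => _ small.
  have [f f_inj] : exists f : 'I_B * 'I_c.+1 -> 'I_m, injective f.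
    by apply: exists_injection; rewrite card_prod !card_ord.
  (* Here [(2 N) ^ 2 <= 4 K B <= B ^ 2], which puts [N / B] in the range of [expR_le_expn]. *)
  have N2B : 2 * N%:R <= B%:R :> R.
    rewrite -(@ler_pXn2r _ 2) ?nnegrE ?mulr_ge0 // exprMn -natrX; nra.
  have NB : (N <= B)%N.
    by rewrite -(ler_nat R); apply: le_trans N2B; rewrite ler_peMl // ler1n.
  apply: le_trans (Perr_ge_birthday phi B0 BL f_inj NB epsc).
  rewrite ler_wpM2r //.
  have -> : - (4 * K) = 2%:R * - (2 * K) by ring.
  rewrite expRM_natl lerXn2r ?nnegrE ?expR_ge0 //.
    by rewrite exprn_ge0 // subr_ge0 ler_pdivrMr // mul1r ler_nat.
  apply: le_trans (expR_le_expn N _); last first.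
    by rewrite divr_ge0 //= ler_pdivrMr //; lra.
  rewrite ler_expR lerN2 ler_wpM2l // mulrA ler_pdivrMr // -natrM.
  by rewrite mulnn.
have [f f_inj] : exists f : 'I_B * bool -> 'I_m, injective f.
  apply: exists_injection; rewrite card_prod card_ord card_bool.
  by apply: leq_trans Bm; rewrite leq_mul2l ltnS c0 orbT.
(* Here [4 K N <= N n <= K B], so that [2 N / B] is at most 1/2. *)
have N4B : 4 * N%:R <= B%:R :> R.
  rewrite -(ler_pM2l K0); apply: le_trans small; rewrite natrM mulrCA mulrA mulrC.
  by rewrite ler_wpM2l // ltW.
have NB : (2 * N <= B)%N.
  rewrite -(ler_nat R) natrM; apply: le_trans N4B; rewrite ler_wpM2r //; lra.
apply: le_trans (Perr_ge_avoid phi B0 BL f_inj NB _); last first.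
  by apply: le_trans epsc _; rewrite gerBl ltW.
apply: (@le_trans _ _ (expR (- (4 * K)) / 2)); first by lra.
rewrite ler_wpM2r //.
apply: le_trans (expR_le_expn n _); last first.
  by rewrite divr_ge0 //= ler_pdivrMr // natrM; lra.
rewrite ler_expR lerN2 mulrA mulrA ler_pdivrMr // natrM.
by move: small; rewrite natrM; nra.
Qed.

Lemma consistent_necessary (eps cbar : R) (c : nat) (N n : nat -> nat)
    (phi : forall m, word m (N m) -> word m (N m) -> word m (n m) -> bool) :
  (0 < c)%N -> eps <= 2 - 2 / c.+1%:R -> 2 * c.+1%:R <= cbar ->
  (forall m, (0 < N m)%N) -> (forall m, (0 < n m)%N) ->
  tends_to_infty n -> asympt_consistent eps cbar phi ->
  (fun m => m%:R / (minn (N m ^ 2) (N m * n m))%:R : R) @ \oo --> (0 : R).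
Proof.
move=> c0 epsc cbarc N0 n0 ninf /cvgrPdist_lt cons.
apply/cvgrPdist_le => e e0.
pose q : R := c.+1%:R; have q0 : 0 < q by rewrite ltr0n.
(* With [m <= 2 q B], a ratio above [e] gives a minimum below [m / e <= K B], so the error stays
   above a constant that depends on [e] and [c] only. *)
pose K := 2 * q / e; have K0 : 0 < K by rewrite divr_gt0 // mulr_gt0.
have d0 : 0 < expR (- (4 * K)) / 4 by rewrite divr_gt0 ?expR_gt0.
have [M1 _ consM] := cons _ d0.
pose T := (Num.truncn (4 * K)).+1.
have KT : 4 * K < T%:R by exact: truncnS_gt.
have [M2 nM] := ninf T.
exists (maxn M1 (maxn M2 (T * c.+1))) => // m /=.
rewrite !geq_max => /and3P[/consM Perr_lt /nM nT Tm].
(* As many blocks of [c.+1] letters as fit. The remainder is why the bounds [m <= 2 q B] and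
   [2 * c.+1 <= cbar] carry a factor 2. *)
pose B := (m %/ c.+1)%N.
have TB : (T <= B)%N by rewrite leq_divRL.
have B0 : (0 < B)%N by exact: leq_trans TB.
have m0 : (0 < m)%N by apply: leq_trans Tm; rewrite muln_gt0.
have mB : m%:R <= 2 * q * B%:R.
  rewrite /q -!natrM ler_nat; apply: leq_trans (ltnW (ltn_ceil m (ltn0Sn c))) _.
  rewrite -/B -mulnA mulnCA mulnC leq_mul2l.
  by rewrite mul2n -addnn -[B.+1]addn1 leq_add2l B0 orbT.
set r := m%:R / _; have r0 : 0 <= r by rewrite divr_ge0.
rewrite sub0r normrN ger0_norm // leNgt; apply/negP => er.
have min0 : (0 < minn (N m ^ 2) (N m * n m))%N.
  by rewrite leq_min expn_gt0 muln_gt0 N0 n0.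
move: Perr_lt; rewrite sub0r normrN ger0_norm ?Perr_ge0 // ltNge => /negP; apply.
apply: (@Perr_ge_const _ _ _ _ _ _ B c) => //; first exact: leq_trunc_div.
- rewrite ler_pdivlMr ?ltr0n // mulrC ler_pdivrMr ?ltr0n //.
  by apply: le_trans mB _; rewrite ler_wpM2r.
- by apply: lt_le_trans KT _; rewrite ler_nat.
- by apply: lt_le_trans KT _; rewrite ler_nat.
- rewrite /K mulrAC ler_pdivlMr //; apply: le_trans mB.
  by move: er; rewrite /r ltr_pdivlMr ?ltr0n // mulrC => /ltW.
Qed.
End Necessity.

Theorem theorem1 (R : realType) (eps : R) (heps0 : 0 < eps) (heps2 : eps < 2) :
  exists C0 : R, forall cbar : R, C0 <= cbar ->
  forall N n : nat -> nat,
    (forall m, (0 < N m)%N) -> (forall m, (0 < n m)%N) ->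
    tends_to_infty N -> tends_to_infty n ->
    ((exists phi : forall m : nat,
          word m (N m) -> word m (N m) -> word m (n m) -> bool,
        asympt_consistent eps cbar phi)
     <->
     (fun m : nat => (m%:R : R) / (minn (N m ^ 2) (N m * n m))%:R) @ \oo --> (0 : R)).
Proof.
(* Blocks must be large enough for [2 - 2 / c.+1] to reach [eps], which is possible because
   [eps < 2]. *)
pose c := (Num.truncn (2 / (2 - eps))).+1.
have epsc : eps <= 2 - 2 / c.+1%:R.
  have lt_c : 2 / (2 - eps) < c.+1%:R.
    by apply: lt_le_trans (truncnS_gt _) _; rewrite ler_nat.
  rewrite lerBrDr -lerBrDl ler_pdivrMr ?ltr0n // mulrC -ler_pdivrMr ?subr_gt0 //.
  exact: ltW.
exists (2 * c.+1%:R) => cbar cbarc N n N0 n0 Ninf ninf; split=> [[phi]|rate].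
  by apply: (@consistent_necessary _ _ _ c) => //; exact: ninf.
exists (fun m => @collision_test R 'I_m (N m) (n m)).
apply: collision_test_consistent => //.
by apply: le_trans cbarc; rewrite mulr_ge0.
Qed.
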